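(* Let $B$ and $C$ be disjoint finite sets, and let $P_1$ and $P_2$ be bipartite graphs on the vertex set $B\cup C$ that are both $(k,\ell)$-biregular: all edges go between $B$ and $C$, all vertices in $B$ have degree $k$, and all vertices in $C$ have degree $\ell$. Suppose that $P_1$ and $P_2$ are cospectral with respect to the adjacency matrix, and that the dimension of the intersection of the eigenspace of the adjacency matrix for the eigenvalue $\lambda=0$ with the subspace of vectors that are nonzero only on $B$ is the same for $P_1$ and for $P_2$. Let $A$ and $A'$ be finite sets such that $A,A',B,C$ are pairwise disjoint. Let $G_1$ be a graph on the vertex set $A\cup A'\cup B\cup C$ such that: $G_1[A\cup A']$ is an arbitrary graph; $G_1[B]$ and $G_1[C]$ have no edges; there are no edges between $A$ and $B$, between $A$ and $C$, or between $A'$ and $C$; every vertex of $A'$ is adjacent to every vertex of $B$; and $G_1[B\cup C]=P_1$. Let $G_2$ be the graph on the same vertex set which is the same as $G_1$ except that $G_2[B\cup C]=P_2$ (in particular $G_2[A\cup A']=G_1[A\cup A']$). For $j\in\{1,2\}$ let $H_j$ be the graph that differs from $G_j$ only in that $H_j[B]$ is the complete graph on $B$. Then for every real number $t$: (i) $G_1$ and $G_2$ are cospectral with respect to the matrix $\mathrm{Adj}+tD$; (ii) $H_1$ and $H_2$ are cospectral with respect to the matrix $\mathrm{Adj}+tD$.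
   Context: All graphs are finite, simple and undirected. For a graph $G$ and a subset $W$ of its vertices, $G[W]$ is the induced subgraph on $W$. $\mathrm{Adj}$ denotes the adjacency matrix of a graph and $D$ its diagonal matrix of degrees. Two graphs are cospectral with respect to a matrix if the associated matrices have the same eigenvalues with the same multiplicities. A vector is ''nonzero only on $B$'' if its entries at all vertices outside $B$ are $0$. *)

(* Defs.v *)
From mathcomp Require Import all_boot all_order all_algebra.
From mathcomp Require Import reals.

Set Implicit Arguments.
Unset Strict Implicit.
Unset Printing Implicit Defensive.

Import GRing.Theory.
Local Open Scope ring_scope.

Record sgraph (V : finType) := SGraph {
  edge :> rel V;
  edge_sym : symmetric edge;
  edge_irr : irreflexive edge }.

Definition deg (V : finType) (G : sgraph V) (v : V) : nat :=
  #|[set w | G v w]|.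

Definition differ_only_in (V : finType) (W : {set V}) (G G' : sgraph V) : Prop :=
  forall x y, ~~ ((x \in W) && (y \in W)) -> G x y = G' x y.

(* Disjoint vertex sets B and C are rendered as the two summands of B + C. *)
Definition biregular (B C : finType) (P : sgraph (B + C)%type) (k l : nat) : Prop :=
  [/\ forall b b' : B, ~~ P (inl b) (inl b'),
      forall c c' : C, ~~ P (inr c) (inr c'),
      forall b : B, deg P (inl b) = k
    & forall c : C, deg P (inr c) = l].

(* Matrices indexed by V use the library enumeration of V. *)
Definition adj_mx (R : realType) (V : finType) (G : sgraph V) : 'M[R]_#|V| :=
  \matrix_(i, j) (G (enum_val i) (enum_val j))%:R.

Definition deg_mx (R : realType) (V : finType) (G : sgraph V) : 'M[R]_#|V| :=
  diag_mx (\row_i (deg G (enum_val i))%:R).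

(* Multiplicities are algebraic, and only real eigenvalues are compared. This
   is meant for real symmetric matrices: their eigenvalues are all real, with
   equal algebraic and geometric multiplicities. *)
Definition cospectral (R : realType) (n : nat) (M N : 'M[R]_n) : Prop :=
  forall a : R, mup a (char_poly M) = mup a (char_poly N).

(* A subspace is represented, as in mxalgebra, by the row space of a matrix;
   supported_onP below identifies this one. *)
Definition supported_on (R : realType) (V : finType) (W : {set V}) : 'M[R]_#|V| :=
  diag_mx (\row_i (enum_val i \in W)%:R).

Lemma supported_onP (R : realType) (V : finType) (W : {set V})
    (u : 'rV[R]_#|V|) :
  reflect (forall i, enum_val i \notin W -> u 0 i = 0)
          (u <= supported_on R W)%MS.
Proof.
apply: (iffP submxP) => [[w ->] i iW|u0].
  by rewrite mul_mx_diag !mxE (negbTE iW) mulr0.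
exists u; apply/rowP => i; rewrite mul_mx_diag !mxE.
by case: (boolP (enum_val i \in W)) => [_|/u0 ->]; rewrite ?mulr1 ?mul0r.
Qed.

(* Main.v *)
(* Let [N] be the biadjacency matrix of [P]. Biregularity gives the block matrix
   [[alpha I, -N], [-N^T, beta I]] the same solution [z] of [Q z = 1_B] for [P1]
   and [P2], namely one constant on [B] and on [C]. Evaluate the characteristic
   polynomial at [x]: the [B + C] block of [x - (Adj + t D)] is such a [Q], up to
   a multiple of [1_B 1_B^T] for [H_j], and it is bordered through [1_A' 1_B^T].
   Hence [z] performs the elimination: the determinant is [\det Q] times factors
   that depend on [z] and not on [P]. Finally
     \det Q = beta ^ (|C| - |B|) * (char_poly (N N^T)).[alpha * beta],
   and the case [alpha = beta = x] shows that the spectrum of [P] determines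
   [char_poly (N N^T)]. This holds for all but finitely many [x]. *)

Require Import Defs.
From mathcomp Require Import all_boot all_order all_algebra.
From mathcomp Require Import reals.
From mathcomp Require Import perm spectral sesquilinear complex.
From mathcomp Require Import ring.

Set Implicit Arguments.
Unset Strict Implicit.
Unset Printing Implicit Defensive.

Import GRing.Theory.
Local Open Scope ring_scope.

(** * Polynomial identities and spectra of real symmetric matrices *)

Lemma char_poly_horner (F : comNzRingType) (n : nat) (M : 'M[F]_n) (x : F) :
  (char_poly M).[x] = \det (x%:M - M).
Proof.
rewrite -horner_evalE -det_map_mx; congr (\det _); apply/matrixP => i j.
by rewrite !mxE rmorphB rmorphMn /= /horner_eval hornerX hornerC.
Qed.

(** The product [r * (p - q)] vanishes everywhere, hence is zero in characteristic 0. This lets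
    determinant identities ignore the finitely many [x] where a division fails. *)
Lemma eq_poly_off_roots (F : numDomainType) (p q r : {poly F}) :
  r != 0 -> (forall x, r.[x] != 0 -> p.[x] = q.[x]) -> p = q.
Proof.
move=> r0 pq; apply/eqP; rewrite -subr_eq0; apply/negP => /negP pq0.
have := mulf_neq0 r0 pq0; set g := r * _ => g0.
(* These are [size g] distinct points, one more than the degree of [g]. *)
pose s := [seq i%:R : F | i <- iota 0 (size g)].
have s_uniq : uniq s.
  by rewrite map_inj_uniq ?iota_uniq //; apply: Num.Theory.mulrIn; rewrite oner_eq0.
have /(max_poly_roots g0)/(_ s_uniq) : all (root g) s; last first.
  by rewrite size_map size_iota ltnn.
apply/allP => x _; rewrite /root hornerM hornerD hornerN mulf_eq0.
by have [//|/pq ->/=] := eqVneq r.[x] 0; rewrite subrr.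
Qed.

(** Over the complexification [M] is Hermitian, hence unitarily diagonalizable with real diagonal;
    the factorization descends because embedding the coefficients is injective. *)
Lemma symmetric_char_poly_split (R : rcfType) (n : nat) (M : 'M[R]_n) :
  M^T = M -> exists s : seq R, char_poly M = \prod_(x <- s) ('X - x%:P).
Proof.
move=> Msym; pose MC := map_mx (real_complex R) M.
have MCherm : MC \is hermsymmx.
  apply: realsym_hermsym; last first.
    by apply/mxOverP => i j; rewrite mxE complex_real.
  by apply/is_hermitianmxP; rewrite expr0 scale1r map_mx_id // /MC map_trmx Msym.
have /mxOverP dreal := hermitian_spectral_diag_real MCherm.
have /orthomx_spectralP := hermitian_normalmx MCherm.
set U := spectralmx MC; set d := spectral_diag MC => MCE.
exists [seq Re (d 0 i) | i : 'I_n].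
apply: (map_poly_inj (real_complex R)); rewrite map_char_poly -/MC.
have -> : char_poly MC = char_poly (diag_mx d).
  apply: (@eq_poly_off_roots _ _ _ 1) => [|x _]; first exact: oner_neq0.
  have U_unit : U \in unitmx := spectral_unit MC.
  rewrite !char_poly_horner.
  have -> : x%:M - MC = invmx U *m (x%:M - diag_mx d) *m U.
    rewrite mulmxBr mulmxBl -MCE -mulmxA mul_scalar_mx -scalemxAr mulVmx //.
    by rewrite scalemx1.
  by rewrite !det_mulmx mulrAC -det_mulmx mulVmx // det1 mul1r.
rewrite char_poly_trig ?diag_mx_is_trig //= big_map rmorph_prod big_enum /=.
apply: eq_bigr => i _; rewrite rmorphB /= map_polyX map_polyC /= RRe_real //.
by rewrite mxE eqxx mulr1n.
Qed.

(* [cospectral] compares real roots only; symmetry ensures there are no others. *)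
Lemma symmetric_cospectral_char_poly (R : realType) (n : nat) (M N : 'M[R]_n) :
  M^T = M -> N^T = N -> cospectral M N -> char_poly M = char_poly N.
Proof.
move=> /symmetric_char_poly_split[s Ms] /symmetric_char_poly_split[s' Ns'] MN.
have : perm_eq s s'.
  by apply/allP => x _ /=; apply/eqP; rewrite -!mu_prod_XsubC -Ms -Ns' MN.
by rewrite Ms Ns'; apply: perm_big.
Qed.

(** The product has size 3, a constant at most 1. *)
Lemma quadratic_neq0 (F : idomainType) (a b c : F) :
  ('X - a%:P) * ('X - b%:P) - c%:P != 0.
Proof.
rewrite subr_eq0; apply/eqP => /(congr1 (size : {poly F} -> nat)).
rewrite size_polyC size_mul ?polyXsubC_eq0 // !size_XsubC.
by case: eqP.
Qed.

(** * Block determinants and reindexing *)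

(** Column elimination with [z a^T] clears the lower left block since [Q z = y]. The solution [z]
    stands in for an inverse of [Q], which may be singular. *)
Lemma det_bordered (F : comNzRingType) m n (X : 'M[F]_m) (a : 'cV_m)
    (y z : 'cV_n) (Q : 'M_n) : Q *m z = y ->
  \det (block_mx X (- (a *m y^T)) (- (y *m a^T)) Q)
  = \det (X - a *m y^T *m z *m a^T) * \det Q.
Proof.
move=> Qz; rewrite -(@det_ublock _ _ _ _ (- (a *m y^T))).
rewrite -[LHS]mulr1.
rewrite -[X in _ * X](_ : \det (block_mx 1%:M 0 (z *m a^T) 1%:M) = 1).
  rewrite -det_mulmx mulmx_block !mulmx1 !mulmx0 add0r mulNmx !mulmxA Qz.
  by rewrite addNr add0r.
by rewrite det_lblock !det1 mulr1.
Qed.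

(** Substituting [Q z] for the left [y] pulls out the factor [Q]. *)
Lemma det_rank1_update (F : comNzRingType) n (y z : 'cV[F]_n) (Q : 'M_n) (e : F) :
  Q *m z = y ->
  \det (Q - e *: (y *m y^T)) = \det Q * \det (1%:M - e *: (z *m y^T)).
Proof.
by move=> Qz; rewrite -det_mulmx mulmxBr mulmx1 -scalemxAr mulmxA Qz.
Qed.

(** The Schur complement of [b I] is [a - b^-1 N N^T = b^-1 (a b - N N^T)], whose [m] rows
    contribute [b ^- m]. *)
Lemma det_scalar_border (F : fieldType) m n (a b : F) (N : 'M_(m, n)) : b != 0 ->
  \det (block_mx a%:M (- N) (- N^T) b%:M)
  = b ^+ n / b ^+ m * (char_poly (N *m N^T)).[a * b].
Proof.
move=> b0; rewrite char_poly_horner.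
rewrite -[LHS]mulr1.
rewrite -[X in _ * X](_ : \det (block_mx 1%:M 0 (b^-1 *: N^T) 1%:M) = 1).
  rewrite -det_mulmx mulmx_block !mulmx1 !mulmx0 add0r.
  rewrite mul_scalar_mx scalerA divff //.
  rewrite scale1r addNr add0r det_ublock det_scalar mulNmx -scalemxAr.
  rewrite (_ : _ + _ = b^-1 *: ((a * b)%:M - N *m N^T)).
    by rewrite detZ exprVn mulrC mulrA.
  by rewrite scalerBr scale_scalar_mx mulrCA mulVf ?mulr1.
by rewrite det_lblock !det1 mulr1.
Qed.

Lemma det_mxsub_bij (F : comNzRingType) m n (f : 'I_m -> 'I_n) (M : 'M[F]_n) :
  bijective f -> \det (mxsub f f M) = \det M.
Proof.
move=> f_bij; have mn : m = n.
  by rewrite -(card_ord m) -(card_ord n) (bij_eq_card f_bij).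
case: n / mn f M f_bij => f M /bij_inj f_inj.
have -> : mxsub f f M = row_perm (perm f_inj) (col_perm (perm f_inj) M).
  by apply/matrixP => i j; rewrite !mxE !permE.
rewrite row_permE col_permE !det_mulmx !det_perm mulrCA.
by rewrite odd_permV -signr_addb addbb mulr1.
Qed.

(** * Matrices indexed by finite types *)

Section FinMatrix.
Variable F : comNzRingType.

Definition fin_mx (V W : finType) (f : V -> W -> F) : 'M[F]_(#|V|, #|W|) :=
  \matrix_(i, j) f (enum_val i) (enum_val j).

Definition fin_cv (V : finType) (f : V -> F) : 'cV[F]_#|V| :=
  \col_i f (enum_val i).

(** The library enumeration of [U + W] is replaced by [g], which lists [U] before [W]; reindexing
    rows and columns alike keeps the determinant. *)
Lemma det_fin_mx_sum (U W : finType) (f : U + W -> U + W -> F) :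
  \det (fin_mx f) =
  \det (block_mx (fin_mx (fun u u' => f (inl u) (inl u')))
                 (fin_mx (fun u w => f (inl u) (inr w)))
                 (fin_mx (fun w u => f (inr w) (inl u)))
                 (fin_mx (fun w w' => f (inr w) (inr w')))).
Proof.
pose g (i : 'I_(#|U| + #|W|)) : U + W :=
  match split i with inl j => inl (enum_val j) | inr j => inr (enum_val j) end.
have g_bij : bijective g.
  exists (fun v => unsplit (match v with inl u => inl (enum_rank u)
                                       | inr w => inr (enum_rank w) end)).
    move=> i; rewrite /g -[RHS]splitK.
    by case: (split i) => j; rewrite enum_valK.
  by case=> v; rewrite /g unsplitK enum_rankK.
rewrite -(@det_mxsub_bij _ _ _ (enum_rank \o g)); last first.
  by apply: bij_comp => //; apply: enum_rank_bij.
congr (\det _); apply/matrixP => i j; rewrite !mxE /= !enum_rankK /g.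
by case: (split i) => i'; rewrite !mxE; case: (split j) => j'; rewrite !mxE.
Qed.

Lemma mul_fin_cv (V W : finType) (f : V -> W -> F) (z : W -> F) :
  fin_mx f *m fin_cv z = fin_cv (fun v => \sum_w f v w * z w).
Proof.
apply/colP => i; rewrite !mxE (big_enum_val (fun w => f _ w * z w)).
by apply: eq_bigr => j _; rewrite !mxE.
Qed.
End FinMatrix.

(** * Biregular bipartite graphs *)

Lemma deg_sum (F : pzSemiRingType) (V : finType) (G : sgraph V) (v : V) :
  (deg G v)%:R = \sum_w (G v w)%:R :> F.
Proof.
rewrite /deg cardsE -sum1_card natr_sum big_mkcond /=.
by apply: eq_bigr => w _; rewrite -[w \in _]/(G v w); case: (G v w).
Qed.

Lemma biregular_sum_inl (F : pzSemiRingType) (B C : finType) k l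
    (P : sgraph (B + C)%type) (b : B) :
  biregular P k l -> \sum_c (P (inl b) (inr c))%:R = k%:R :> F.
Proof.
case=> [PBB _ PB _]; rewrite -(PB b) deg_sum big_sumType /=.
by rewrite [X in _ = X + _]big1 ?add0r // => b' _; rewrite (negbTE (PBB _ _)).
Qed.

Lemma biregular_sum_inr (F : pzSemiRingType) (B C : finType) k l
    (P : sgraph (B + C)%type) (c : C) :
  biregular P k l -> \sum_b (P (inr c) (inl b))%:R = l%:R :> F.
Proof.
case=> [_ PCC _ PC]; rewrite -(PC c) deg_sum big_sumType /=.
by rewrite [X in _ = _ + X]big1 ?addr0 // => c' _; rewrite (negbTE (PCC _ _)).
Qed.

Section BipartiteBlock.
Variables (F : fieldType) (B C : finType).
Implicit Types (P : sgraph (B + C)%type) (alpha beta : F).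

Definition biadj P : 'M[F]_(#|B|, #|C|) :=
  fin_mx (fun b c => (P (inl b) (inr c))%:R).

(** Degrees in the glued graph are constant on [B] and on [C], so subtracting [t D] turns [x] into
    one scalar on each side. *)
Definition biscalar_sub_adj alpha beta P : 'M[F]_#|{: B + C}| :=
  fin_mx (fun v w => (if v is inl _ then alpha else beta) *+ (v == w)
                     - (P v w)%:R).

Lemma det_biscalar_sub_adj alpha beta P k l : biregular P k l -> beta != 0 ->
  \det (biscalar_sub_adj alpha beta P)
  = beta ^+ #|C| / beta ^+ #|B|
    * (char_poly (biadj P *m (biadj P)^T)).[alpha * beta].
Proof.
case=> [PBB PCC _ _] beta0; rewrite -det_scalar_border // det_fin_mx_sum.
congr (\det (block_mx _ _ _ _)); apply/matrixP => i j; rewrite !mxE.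
- by rewrite (negbTE (PBB _ _)) subr0 (inj_eq inl_inj) (inj_eq enum_val_inj).
- by rewrite mulr0n sub0r.
- by rewrite mulr0n sub0r edge_sym.
- by rewrite (negbTE (PCC _ _)) subr0 (inj_eq inr_inj) (inj_eq enum_val_inj).
Qed.

(* On vectors constant on [B] and on [C], a [(k, l)]-biregular graph acts by a
   2 x 2 matrix; this solves the corresponding 2 x 2 linear system. *)
Lemma biscalar_sub_adj_solve alpha beta P k l :
  biregular P k l -> alpha * beta - k%:R * l%:R != 0 ->
  biscalar_sub_adj alpha beta P *m
    fin_cv (fun w => (if w is inl _ then beta else l%:R)
                     / (alpha * beta - k%:R * l%:R))
  = fin_cv (fun w : B + C => if w is inl _ then 1 else 0).
Proof.
move=> P_bireg D0; have [PBB PCC _ _] := P_bireg.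
rewrite mul_fin_cv; set D := _ - _ in D0 *.
apply/colP => i; rewrite !mxE; move: (enum_val i) => v.
under eq_bigr do rewrite mulrBl mulrnAl mulrb.
rewrite sumrB -big_mkcond (big_pred1 v) => [|w]; last exact: eq_sym.
rewrite big_sumType /= -!mulr_suml.
case: v => [b|c].
- rewrite (biregular_sum_inl F b P_bireg) big1.
    by rewrite mul0r add0r !mulrA -mulrBl divff.
  by move=> b' _; rewrite (negbTE (PBB _ _)).
- rewrite (biregular_sum_inr F c P_bireg) big1.
    by rewrite mul0r addr0 !mulrA [beta * _]mulrC subrr.
  by move=> c' _; rewrite (negbTE (PCC _ _)).
Qed.
End BipartiteBlock.

(** For [alpha = beta = x] the determinant formula evaluates the characteristic polynomial of the
    adjacency matrix; cancelling powers of [x] leaves an equality at [x ^ 2]. *)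
Lemma biadj_char_poly_cospectral (R : realType) (B C : finType) (k l : nat)
    (P1 P2 : sgraph (B + C)%type) :
  biregular P1 k l -> biregular P2 k l ->
  cospectral (adj_mx R P1) (adj_mx R P2) ->
  char_poly (biadj R P1 *m (biadj R P1)^T)
  = char_poly (biadj R P2 *m (biadj R P2)^T).
Proof.
move=> bi1 bi2 cosp.
have adj_sym P : (adj_mx R P)^T = adj_mx R P :> 'M_#|{: B + C}|.
  by apply/matrixP => i j; rewrite !mxE edge_sym.
have adjE (P : sgraph (B + C)%type) (x : R) :
    biscalar_sub_adj x x P = x%:M - adj_mx R P.
  apply/matrixP => i j; rewrite !mxE (inj_eq enum_val_inj).
  by case: (enum_val i).
have cpE :=
  symmetric_cospectral_char_poly (adj_sym P1) (adj_sym P2) cosp.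
(* Only values at squares are controlled; substituting ['X^2] is injective on polynomials. *)
apply/eqP; rewrite -subr_eq0 -(@comp_poly_eq0 _ _ 'X^2) ?size_polyXn //.
rewrite comp_polyB subr_eq0; apply/eqP.
apply: (@eq_poly_off_roots _ _ _ 'X) => [|x]; first by rewrite polyX_eq0.
rewrite hornerX => x0; rewrite !horner_comp hornerXn expr2.
have := det_biscalar_sub_adj x bi1 x0; rewrite adjE -char_poly_horner cpE.
rewrite char_poly_horner -adjE (det_biscalar_sub_adj x bi2 x0).
by move/mulfI=> -> //; rewrite mulf_neq0 ?invr_eq0 ?expf_neq0.
Qed.

(** * The glued graph and its determinant *)

(* With [U = A + A'] and [a] the membership in [A'], this is the edge relation of
   [G_j] for [e = false] and of [H_j] for [e = true]. *)
Definition glue (U B C : finType) (K : rel U) (a : pred U) (e : bool)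
    (P : rel (B + C)) : rel (U + (B + C)) := fun v w =>
  match v, w with
  | inl u, inl u' => K u u'
  | inl u, inr (inl _) | inr (inl _), inl u => a u
  | inr (inl b), inr (inl b') => e && (b != b')
  | inr x, inr y => P x y
  | _, _ => false
  end.

Section Glue.
Variables (R : realType) (U B C : finType) (K : rel U) (a : pred U) (e : bool).
Variables (k l : nat) (t x : R).

(** Degrees in the glued graph, expressed through data common to both graphs and free of [P]. *)
Definition glue_deg_inl (u : U) : R :=
  \sum_u' (K u u')%:R + (#|B| * a u)%:R.

Definition glue_deg_B : R := #|a|%:R + #|B|.-1%:R *+ e + k%:R.

(* [K_B = J - I]: for [e = true] the diagonal of the complete graph on [B] moves
   into [alpha], leaving the rank one matrix [1_B 1_B^T]. *)
Definition glue_alpha : R := x + e%:R - t * glue_deg_B.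
Definition glue_beta : R := x - t * l%:R.
Definition glue_denom : R := glue_alpha * glue_beta - k%:R * l%:R.
(* [1_B^T z] for the solution [z = glue_sol] of [Q z = 1_B]. *)
Definition glue_weight : R := #|B|%:R * (glue_beta / glue_denom).

Definition ind_B : 'cV[R]_#|{: B + C}| :=
  fin_cv (fun w => if w is inl _ then 1 else 0).
Definition ind_a : 'cV[R]_#|U| := fin_cv (fun u => (a u)%:R).
Definition glue_sol : 'cV[R]_#|{: B + C}| :=
  fin_cv (fun w => (if w is inl _ then glue_beta else l%:R) / glue_denom).

Definition glue_core : 'M[R]_#|U| :=
  fin_mx (fun u u' => (x - t * glue_deg_inl u) *+ (u == u') - (K u u')%:R).

(** On the right, [P] enters only through the determinant of [biscalar_sub_adj]. *)
Lemma glue_det (P : sgraph (B + C)%type) (G : sgraph (U + (B + C))%type) :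
  biregular P k l -> G =2 glue K a e P ->
  glue_denom != 0 -> 1 - e%:R * glue_weight != 0 ->
  \det (x%:M - (adj_mx R G + t *: deg_mx R G))
  = \det (glue_core - ind_a *m ind_B^T
            *m ((1 - e%:R * glue_weight)^-1 *: glue_sol) *m ind_a^T)
    * (\det (biscalar_sub_adj glue_alpha glue_beta P)
       * \det (1%:M - e%:R *: (glue_sol *m ind_B^T))).
Proof.
move=> P_bireg GE D0 w0; have [PBB PCC _ _] := P_bireg.
have Q0z := biscalar_sub_adj_solve P_bireg D0.
rewrite -/glue_denom -/glue_sol -/ind_B in Q0z.
(* If [Q z = 1_B] and [w = 1_B^T z], then [(Q - e 1_B 1_B^T) z = (1 - e w) 1_B]; this explains the
   rescaled solution. *)
rewrite -(det_rank1_update _ Q0z) -det_bordered; last first.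
  have sum_sol : ind_B^T *m glue_sol = glue_weight%:M.
    apply/rowP => i; rewrite !ord1 !mxE /=.
    under eq_bigr do rewrite !mxE.
    rewrite -(big_enum_val (fun w : B + C => (if w is inl _ then 1 else 0)
      * ((if w is inl _ then glue_beta else l%:R) / glue_denom))) big_sumType /=.
    under eq_bigr do rewrite mul1r.
    rewrite sumr_const [X in _ + X]big1 => [|c _]; last by rewrite mul0r.
    by rewrite addr0 mulr1n /glue_weight mulr_natl.
  rewrite -scalemxAr mulmxBl Q0z -scalemxAl -mulmxA sum_sol mul_mx_scalar scalerA.
  by rewrite -{1}[ind_B]scale1r -scalerBl scalerA mulVf // scale1r.
have degL u : (deg G (inl u))%:R = glue_deg_inl u.
  rewrite deg_sum big_sumType /=; congr (_ + _).
    by apply: eq_bigr => u' _; rewrite GE.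
  rewrite big_sumType /= [X in _ + X]big1 => [|c _]; last by rewrite GE.
  under eq_bigr do rewrite GE.
  by rewrite addr0 sumr_const mulnC natrM mulr_natr.
have degB b : (deg G (inr (inl b)))%:R = glue_deg_B.
  rewrite deg_sum big_sumType /= /glue_deg_B -addrA; congr (_ + _).
    rewrite -sum1_card natr_sum [RHS]big_mkcond /=.
    by apply: eq_bigr => u _; rewrite GE /= -[u \in a]/(a u); case: (a u).
  rewrite big_sumType /=; congr (_ + _).
    under eq_bigr do rewrite GE /=.
    rewrite -(cardC1 b) -sum1_card natr_sum -sumrMnl [RHS]big_mkcond /=.
    by apply: eq_bigr => b' _; rewrite eq_sym !inE; case: e (b' != b) => [] [].
  by rewrite -(biregular_sum_inl R b P_bireg); apply: eq_bigr => c _; rewrite GE.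
have degC c : (deg G (inr (inr c)))%:R = l%:R :> R.
  rewrite deg_sum big_sumType /= big1 => [|u _]; last by rewrite GE.
  rewrite add0r big_sumType /= [X in _ + X]big1 => [|c' _].
    rewrite addr0 -(biregular_sum_inr R c P_bireg).
    by apply: eq_bigr => b _; rewrite GE.
  by rewrite GE /= (negbTE (PCC _ _)).
have -> : x%:M - (adj_mx R G + t *: deg_mx R G)
    = fin_mx (fun v w => (x - t * (deg G v)%:R) *+ (v == w) - (G v w)%:R).
  apply/matrixP => i j; rewrite !mxE (inj_eq enum_val_inj).
  case: eqP => _; rewrite ?mulr1n ?mulr0n ?mulr0 ?addr0 //; ring.
rewrite det_fin_mx_sum; congr (\det (block_mx _ _ _ _)).
- apply/matrixP => i j; rewrite !mxE degL GE.
  by rewrite (inj_eq inl_inj).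
- apply/matrixP => i j; rewrite !mxE big_ord1 !mxE GE mulr0n sub0r.
  by case: (enum_val j) => [b|c] /=; rewrite ?mulr1 ?mulr0.
- apply/matrixP => i j; rewrite !mxE big_ord1 !mxE GE mulr0n sub0r.
  by case: (enum_val i) => [b|c] /=; rewrite ?mul1r ?mul0r.
- apply/matrixP => i j; rewrite !mxE big_ord1 !mxE GE (inj_eq inr_inj).
  case: (enum_val i) (enum_val j) => [b|c] [b'|c'] /=;
    rewrite ?degB ?degC ?mul0r ?mulr0 ?mulr1 ?subr0 //.
    rewrite (negbTE (PBB _ _)) (inj_eq inl_inj) /glue_alpha.
    by case: e; case: eqP => _ /=; ring.

Qed.
End Glue.

Lemma glue_char_poly (R : realType) (U B C : finType) (K : rel U) (a : pred U)
    (e : bool) (k l : nat) (t : R) (P1 P2 : sgraph (B + C)%type)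
    (G1 G2 : sgraph (U + (B + C))%type) :
  biregular P1 k l -> biregular P2 k l ->
  cospectral (adj_mx R P1) (adj_mx R P2) ->
  G1 =2 glue K a e P1 -> G2 =2 glue K a e P2 ->
  char_poly (adj_mx R G1 + t *: deg_mx R G1)
  = char_poly (adj_mx R G2 + t *: deg_mx R G2).
Proof.
move=> bi1 bi2 cosp G1E G2E.
(* Chosen so that [glue_beta = x - b] and [glue_alpha = x - c]. *)
pose b := t * l%:R; pose c := t * glue_deg_B R B a e k - e%:R.
pose s := e%:R * #|B|%:R : R; pose m := k%:R * l%:R : R.
(* The factors exclude the zeros of [glue_beta], of [glue_denom], and of
   [glue_denom * (1 - e * glue_weight)], in this order. *)
apply: (@eq_poly_off_roots _ _ _
  (('X - b%:P) * ((('X - c%:P) * ('X - b%:P) - m%:P)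
                  * (('X - (c + s)%:P) * ('X - b%:P) - m%:P)))) => [|x].
  by rewrite !mulf_neq0 ?quadratic_neq0 // polyXsubC_eq0.
rewrite !hornerE !mulf_eq0 !negb_or -andbA => /and3P[b0 D0 E0].
have denE : glue_denom B a e k l t x = (x - c) * (x - b) - m.
  by rewrite /glue_denom /glue_alpha /glue_beta /c /b /m; ring.
have den0 : glue_denom B a e k l t x != 0 by rewrite denE.
have w0 : 1 - e%:R * glue_weight B a e k l t x != 0.
  rewrite -(mulIr_eq0 _ (mulIf den0)) mulrBl mul1r /glue_weight mulrA -/s.
  rewrite -[_ / _]/(_ * _) !mulrA mulfVK // denE /glue_beta -/b.
  by apply: contra E0 => /eqP E0; apply/eqP; rewrite -E0; ring.
rewrite !char_poly_horner (glue_det bi1 G1E den0 w0) (glue_det bi2 G2E den0 w0).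
rewrite (det_biscalar_sub_adj _ bi1 b0) (det_biscalar_sub_adj _ bi2 b0).
by rewrite (biadj_char_poly_cospectral bi1 bi2 cosp).
Qed.

Theorem theorem3 (R : realType) (B C : finType) (k l : nat)
    (P1 P2 : sgraph (B + C)%type)
    (P1_bireg : biregular P1 k l) (P2_bireg : biregular P2 k l)
    (P_cospectral : cospectral (adj_mx R P1) (adj_mx R P2))
    (P_null : let inB := supported_on R [set (inl b : B + C) | b : B] in
       \rank (eigenspace (adj_mx R P1) 0 :&: inB)%MS
       = \rank (eigenspace (adj_mx R P2) 0 :&: inB)%MS)
    (A A' : finType)
    (G1 G2 H1 H2 : sgraph ((A + A') + (B + C))%type)
    (G1_BB : forall b b' : B, ~~ G1 (inr (inl b)) (inr (inl b')))
    (G1_CC : forall c c' : C, ~~ G1 (inr (inr c)) (inr (inr c')))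
    (G1_AB : forall (a : A) (b : B), ~~ G1 (inl (inl a)) (inr (inl b)))
    (G1_AC : forall (a : A) (c : C), ~~ G1 (inl (inl a)) (inr (inr c)))
    (G1_A'C : forall (a : A') (c : C), ~~ G1 (inl (inr a)) (inr (inr c)))
    (G1_A'B : forall (a : A') (b : B), G1 (inl (inr a)) (inr (inl b)))
    (G1_BC : forall x y : B + C, G1 (inr x) (inr y) = P1 x y)
    (G2_G1 : differ_only_in [set (inr x : (A + A') + (B + C)) | x : B + C] G2 G1)
    (G2_BC : forall x y : B + C, G2 (inr x) (inr y) = P2 x y)
    (H1_G1 : differ_only_in
       [set (inr (inl b) : (A + A') + (B + C)) | b : B] H1 G1)
    (H1_BB : forall b b' : B, H1 (inr (inl b)) (inr (inl b')) = (b != b'))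
    (H2_G2 : differ_only_in
       [set (inr (inl b) : (A + A') + (B + C)) | b : B] H2 G2)
    (H2_BB : forall b b' : B, H2 (inr (inl b)) (inr (inl b')) = (b != b')) :
  forall t : R,
    cospectral (adj_mx R G1 + t *: deg_mx R G1) (adj_mx R G2 + t *: deg_mx R G2)
    /\
    cospectral (adj_mx R H1 + t *: deg_mx R H1) (adj_mx R H2 + t *: deg_mx R H2).
Proof.
move=> t; pose K : rel (A + A') := fun u u' => G1 (inl u) (inl u').
pose a : pred (A + A') := fun u => if u is inr _ then true else false.
have G1E : G1 =2 glue K a false P1.
  move=> [[u|u]|[b|c]] [[u'|u']|[b'|c']] //=; rewrite ?G1_BC ?G1_A'B //;
    try (by apply/negbTE; rewrite ?G1_AB ?G1_AC ?G1_A'C //);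
    try (by rewrite edge_sym; apply/negbTE; rewrite ?G1_AB ?G1_AC ?G1_A'C //).
  - by rewrite edge_sym G1_A'B.
  - by rewrite -G1_BC; apply/negbTE.
have G2E : G2 =2 glue K a false P2.
  move=> [u|y] [u'|y'].
  - rewrite G2_G1 ?G1E // negb_and; apply/orP; left.
    by apply/imsetP => -[].
  - rewrite G2_G1 ?G1E; first by case: y' => [].
    by rewrite negb_and; apply/orP; left; apply/imsetP => -[].
  - rewrite G2_G1 ?G1E; first by case: y => [].
    by rewrite negb_and; apply/orP; right; apply/imsetP => -[].
  - rewrite G2_BC; case: y y' => [b|c] [b'|c'] //=.
    by case: P2_bireg => PBB _ _ _; apply/negbTE.
(* Completing [B] only switches [e] to [true]: away from pairs in [B], [glue] ignores [e]. *)
have addK (G H : sgraph ((A + A') + (B + C))%type) P :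
    G =2 glue K a false P ->
    differ_only_in [set (inr (inl b) : (A + A') + (B + C)) | b : B] H G ->
    (forall b b' : B, H (inr (inl b)) (inr (inl b')) = (b != b')) ->
    H =2 glue K a true P.
  move=> GE HG HBB v w; have [/andP[/imsetP[b _ ->] /imsetP[b' _ ->]]|vw] :=
    boolP ((v \in [set (inr (inl b) : (A + A') + (B + C)) | b : B])
           && (w \in [set (inr (inl b) : (A + A') + (B + C)) | b : B])).
    by rewrite HBB.
  rewrite HG // GE; case: v w vw => [u|[b|c]] [u'|[b'|c']] //.
  by rewrite !imset_f.
split=> r; congr (mup r _).
  exact: (glue_char_poly t P1_bireg P2_bireg P_cospectral G1E G2E).
apply: (glue_char_poly t P1_bireg P2_bireg P_cospectral).
  exact: addK G1E H1_G1 H1_BB.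
exact: addK G2E H2_G2 H2_BB.
Qed.
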